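(* Let $\mathcal{S}\subseteq\mathbb{R}^n$ be an open strongly $\mathcal{E}$-invex set with respect to $\Psi:\mathbb{R}^n\times\mathbb{R}^n\to\mathbb{R}^n$, where $\mathcal{E}:\mathbb{R}^n\to\mathbb{R}^n$. Suppose $\tilde{h}=[\tilde h^L,\tilde h^U]:\mathcal{S}\to\mathcal{I}(\mathbb{R})$ is an SLU$\mathcal{E}$I function with respect to $\Psi$ on $\mathcal{S}$, and each $g_i:\mathcal{S}\to\mathbb{R}$, $i=1,\dots,m$, is strongly $\mathcal{E}$-invex (S$\mathcal{E}$I) with respect to $\Psi$ on $\mathcal{S}$. Consider the problem (IVOP): minimize $\tilde h(\mathcal{E}(\zeta))=[\tilde h^L(\mathcal{E}(\zeta)),\tilde h^U(\mathcal{E}(\zeta))]$ subject to $g_i(\mathcal{E}(\zeta))\le0$, $i=1,\dots,m$, with feasible set $P=\{\zeta\in\mathcal{S}:g_i(\mathcal{E}(\zeta))\le0,\ i=1,\dots,m\}$. If $\zeta^*\in P$ and there are real numbers $v_1,\dots,v_m$ such that $$\nabla\tilde h^L(\mathcal{E}(\zeta^* ))+\sum_{i=1}^m v_i\nabla g_i(\mathcal{E}(\zeta^* ))=0,$$ $$\nabla\tilde h^U(\mathcal{E}(\zeta^* ))+\sum_{i=1}^m v_i\nabla g_i(\mathcal{E}(\zeta^* ))=0,$$ $$\sum_{i=1}^m v_i g_i(\mathcal{E}(\zeta^* ))=0,\qquad v_i\ge0\quad(i=1,\dots,m),$$ then $\zeta^*$ is a non-dominated solution of (IVOP).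
   Context: $\mathcal{I}(\mathbb{R})$ is the set of closed bounded intervals $[u^L,u^U]$, $u^L\le u^U$. Operations: $[a,b]+[c,d]=[a+c,b+d]$; $k[a,b]=[ka,kb]$ if $k\ge0$, $[kb,ka]$ if $k<0$. Order: $[a,b]\preceq[c,d]$ iff $a\le c$, $b\le d$; $\prec$ means $\preceq$ and $\ne$. gH-difference: $[a,b]\ominus_{gH}[c,d]=[\min\{a-c,b-d\},\max\{a-c,b-d\}]$. A set $\mathcal{S}$ is strongly $\mathcal{E}$-invex with respect to $\Psi$ if $\alpha\delta+\mathcal{E}(\delta)+\lambda\Psi(\alpha\zeta+\mathcal{E}(\zeta),\alpha\delta+\mathcal{E}(\delta))\in\mathcal{S}$ for all $\zeta,\delta\in\mathcal{S}$, $\alpha,\lambda\in[0,1]$ (in particular $\mathcal{E}(\mathcal{S})\subseteq\mathcal{S}$). The gH-partial derivative is $\frac{\partial\tilde h}{\partial\zeta_i}(\zeta)=\lim_{t\to0}\frac1t\big(\tilde h(\zeta+te_i)\ominus_{gH}\tilde h(\zeta)\big)\in\mathcal{I}(\mathbb{R})$ (limit in the Hausdorff distance $d_H([a,b],[c,d])=\max\{|a-c|,|b-d|\}$), and $\nabla\tilde h(\zeta)$ is the $n$-tuple of these intervals. For $\nu\in\mathbb{R}^n$ and intervals $\mathcal{U}_1,\dots,\mathcal{U}_n$, the gH-product is $\langle\nu,(\mathcal{U}_1,\dots,\mathcal{U}_n)\rangle_{gH}=\sum_{i:\nu_i\ge0}\nu_i\mathcal{U}_i\ominus_{gH}\sum_{k:\nu_k<0}|\nu_k|\mathcal{U}_k$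 (an empty sum is $[0,0]$). For $\mathcal{S}$ an open strongly $\mathcal{E}$-invex set, a gH-differentiable $\tilde h:\mathcal{S}\to\mathcal{I}(\mathbb{R})$ (gH-partial derivatives exist on $\mathcal{S}$) is SLU$\mathcal{E}$I (strongly LU-$\mathcal{E}$-invex) with respect to $\Psi$ on $\mathcal{S}$ if for all $\zeta,\delta\in\mathcal{S}$, $\alpha\in[0,1]$: $$\langle\Psi(\alpha\zeta+\mathcal{E}(\zeta),\alpha\delta+\mathcal{E}(\delta)),\nabla\tilde h(\mathcal{E}(\delta))\rangle_{gH}\preceq\tilde h(\mathcal{E}(\zeta))\ominus_{gH}\tilde h(\mathcal{E}(\delta)).$$ A differentiable $g:\mathcal{S}\to\mathbb{R}$ is S$\mathcal{E}$I with respect to $\Psi$ if for all $\zeta,\delta\in\mathcal{S}$, $\alpha\in[0,1]$: $\Psi(\alpha\zeta+\mathcal{E}(\zeta),\alpha\delta+\mathcal{E}(\delta))^\top\nabla g(\mathcal{E}(\delta))\le g(\mathcal{E}(\zeta))-g(\mathcal{E}(\delta))$. The gradients $\nabla\tilde h^L,\nabla\tilde h^U$ at $\mathcal{E}(\zeta^* )$ appearing in the claim are classical and are assumed to exist ($\tilde h^L,\tilde h^U$ differentiable there). $\zeta^*\in P$ is non-dominated if there is no $\zeta\in P$ with $\tilde h(\mathcal{E}(\zeta))\prec\tilde h(\mathcal{E}(\zeta^* ))$. *)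

(* Defs.v *)
From HB Require Import structures.
From mathcomp Require Import all_boot all_order all_algebra.
From mathcomp Require Import all_classical all_reals all_analysis.

Set Implicit Arguments.
Unset Strict Implicit.
Unset Printing Implicit Defensive.

Import Order.TTheory GRing.Theory Num.Theory.
Import numFieldNormedType.Exports.

Local Open Scope classical_set_scope.
Local Open Scope ring_scope.

(* Closed bounded real intervals, stored as pairs of endpoints. They form a
   subtype of [R * R], so two intervals are equal iff their endpoints are. *)
Record cbitv (R : realType) : Type := Cbitv {
  bounds : R * R;
  _ : bounds.1 <= bounds.2
}.

HB.instance Definition _ (R : realType) := [isSub for @bounds R].
HB.instance Definition _ (R : realType) := [Choice of cbitv R by <:].

Definition lo (R : realType) (a : cbitv R) : R := (bounds a).1.
Definition hi (R : realType) (a : cbitv R) : R := (bounds a).2.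

Lemma lo_le_hi (R : realType) (a : cbitv R) : lo a <= hi a.
Proof. by case: a. Qed.

Definition izero (R : realType) : cbitv R := @Cbitv R (0, 0) (lexx 0).

Lemma iadd_subproof (R : realType) (a b : cbitv R) :
  lo a + lo b <= hi a + hi b.
Proof. by rewrite lerD ?lo_le_hi. Qed.

Definition iadd (R : realType) (a b : cbitv R) : cbitv R :=
  @Cbitv R (lo a + lo b, hi a + hi b) (iadd_subproof a b).

Lemma iscale_subproof (R : realType) (k : R) (a : cbitv R) :
  (if 0 <= k then k * lo a else k * hi a) <=
  (if 0 <= k then k * hi a else k * lo a).
Proof.
case: (lerP 0 k) => k0; first by rewrite ler_wpM2l ?lo_le_hi.
by rewrite ler_wnM2l ?lo_le_hi ?ltW.
Qed.

Definition iscale (R : realType) (k : R) (a : cbitv R) : cbitv R :=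
  @Cbitv R (if 0 <= k then k * lo a else k * hi a,
            if 0 <= k then k * hi a else k * lo a) (iscale_subproof k a).

Lemma gHsub_subproof (R : realType) (a b : cbitv R) :
  Num.min (lo a - lo b) (hi a - hi b) <= Num.max (lo a - lo b) (hi a - hi b).
Proof. by rewrite ge_min le_max lexx. Qed.

Definition gHsub (R : realType) (a b : cbitv R) : cbitv R :=
  @Cbitv R (Num.min (lo a - lo b) (hi a - hi b),
            Num.max (lo a - lo b) (hi a - hi b)) (gHsub_subproof a b).

Definition ile (R : realType) (a b : cbitv R) : Prop :=
  lo a <= lo b /\ hi a <= hi b.

Definition ilt (R : realType) (a b : cbitv R) : Prop := ile a b /\ a <> b.

Definition dH (R : realType) (a b : cbitv R) : R :=
  Num.max `|lo a - lo b| `|hi a - hi b|.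

(* Functions on a set S of R^n are represented by total functions on 'rV[R]_n.
   S is always open, so limits and derivatives at points of S depend only on
   the values taken on S. *)

Definition is_gHpartial (R : realType) (n : nat) (h : 'rV[R]_n -> cbitv R)
    (x : 'rV[R]_n) (i : 'I_n) (D : cbitv R) : Prop :=
  dH (iscale t^-1 (gHsub (h (x + t *: delta_mx 0 i)) (h x))) D
    @[t --> (0 : R)^'] --> (0 : R).

(* The limit is unique when it exists; [izero] is the junk value otherwise. *)
Definition gHgrad (R : realType) (n : nat) (h : 'rV[R]_n -> cbitv R)
    (x : 'rV[R]_n) (i : 'I_n) : cbitv R :=
  xget (izero R) [set D | is_gHpartial h x i D].

Definition gHdifferentiable_on (R : realType) (n : nat) (S : set 'rV[R]_n)
    (h : 'rV[R]_n -> cbitv R) : Prop :=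
  forall x, S x -> forall i, exists D, is_gHpartial h x i D.

Definition gHprod (R : realType) (n : nat) (nu : 'rV[R]_n)
    (U : 'I_n -> cbitv R) : cbitv R :=
  gHsub
    (\big[@iadd R/izero R]_(i < n | 0 <= nu 0 i) iscale (nu 0 i) (U i))
    (\big[@iadd R/izero R]_(k < n | nu 0 k < 0) iscale `|nu 0 k| (U k)).

Definition grad (R : realType) (n : nat) (f : 'rV[R]_n -> R)
    (x : 'rV[R]_n) : 'rV[R]_n :=
  \row_i 'D_(delta_mx 0 i) f x.

Definition dotp (R : realType) (n : nat) (u v : 'rV[R]_n) : R :=
  \sum_(i < n) u 0 i * v 0 i.

Definition strongly_E_invex (R : realType) (n : nat) (S : set 'rV[R]_n)
    (E : 'rV[R]_n -> 'rV[R]_n) (Psi : 'rV[R]_n -> 'rV[R]_n -> 'rV[R]_n) : Prop :=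
  forall z d, S z -> S d -> forall a l : R, 0 <= a <= 1 -> 0 <= l <= 1 ->
    S (a *: d + E d + l *: Psi (a *: z + E z) (a *: d + E d)).

Definition SLUEI (R : realType) (n : nat) (S : set 'rV[R]_n)
    (E : 'rV[R]_n -> 'rV[R]_n) (Psi : 'rV[R]_n -> 'rV[R]_n -> 'rV[R]_n)
    (h : 'rV[R]_n -> cbitv R) : Prop :=
  gHdifferentiable_on S h /\
  forall z d, S z -> S d -> forall a : R, 0 <= a <= 1 ->
    ile (gHprod (Psi (a *: z + E z) (a *: d + E d)) (gHgrad h (E d)))
        (gHsub (h (E z)) (h (E d))).

Definition SEI (R : realType) (n : nat) (S : set 'rV[R]_n)
    (E : 'rV[R]_n -> 'rV[R]_n) (Psi : 'rV[R]_n -> 'rV[R]_n -> 'rV[R]_n)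
    (g : 'rV[R]_n -> R) : Prop :=
  (forall x, S x -> differentiable g x) /\
  forall z d, S z -> S d -> forall a : R, 0 <= a <= 1 ->
    dotp (Psi (a *: z + E z) (a *: d + E d)) (grad g (E d)) <= g (E z) - g (E d).

Definition feasible (R : realType) (n m : nat) (S : set 'rV[R]_n)
    (E : 'rV[R]_n -> 'rV[R]_n) (g : 'I_m -> 'rV[R]_n -> R) : set 'rV[R]_n :=
  [set z | S z /\ forall i, g i (E z) <= 0].

Definition non_dominated (R : realType) (n : nat) (P : set 'rV[R]_n)
    (E : 'rV[R]_n -> 'rV[R]_n) (h : 'rV[R]_n -> cbitv R) (zs : 'rV[R]_n) : Prop :=
  P zs /\ ~ exists z, P z /\ ilt (h (E z)) (h (E zs)).

(* Main.v *)
Require Import Defs.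
From HB Require Import structures.
From mathcomp Require Import all_boot all_order all_algebra.
From mathcomp Require Import all_classical all_reals all_analysis.

Set Implicit Arguments.
Unset Strict Implicit.
Unset Printing Implicit Defensive.

Import Order.TTheory GRing.Theory Num.Theory.
Import numFieldNormedType.Exports.

Local Open Scope classical_set_scope.
Local Open Scope ring_scope.

(** The two stationarity equations say more than it seems: both endpoint gradients equal the same vector
    [w = - \sum_i v i *: grad (g i)], so at [E zs] every gH-partial derivative
    of [h] degenerates to the one-point interval [[w_i, w_i]]
    ([gHgrad_ipoint]).  On one-point intervals the gH-product is the ordinary
    dot product ([gHprod_ipoint]), hence SLUEI at a feasible [z] bounds both
    endpoint increments of [h] between [E zs] and [E z] from below by the
    single number [<nu, w>], with [nu] the corresponding value of [Psi].

    That number is nonnegative by the classical KKT computation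
    ([lagrange_dotp_ge0]): strong invexity of the constraints gives
    [- <nu, w> <= \sum_i v i * (g i (E z) - g i (E zs))], complementary
    slackness removes the terms at [E zs], and feasibility makes the remaining
    ones nonpositive.  So [h (E zs)] lies below [h (E z)] for every feasible
    [z], and antisymmetry of the interval order forbids domination. *)

Definition ipoint {R : realType} (a : R) : cbitv R :=
  @Cbitv R (a, a) (lexx a).

Lemma cbitv_eq (R : realType) (a b : cbitv R) :
  lo a = lo b -> hi a = hi b -> a = b.
Proof.
move=> ab_lo ab_hi; apply: val_inj => /=.
by rewrite [LHS]surjective_pairing [RHS]surjective_pairing; congr pair.
Qed.

Lemma ile_anti (R : realType) (a b : cbitv R) : ile a b -> ile b a -> a = b.
Proof.
by move=> [ab1 ab2] [ba1 ba2]; apply: cbitv_eq; apply/eqP;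
  rewrite eq_le ?ab1 ?ab2 ?ba1 ?ba2.
Qed.

(** The lower endpoint of [gHsub a b] is the smaller of the two endpoint
    increments, so its sign alone decides the order of [a] and [b]. *)
Lemma ile_gHsub_ge0 (R : realType) (a b : cbitv R) :
  0 <= lo (gHsub a b) -> ile b a.
Proof. by rewrite /lo /= le_min !subr_ge0 => /andP[]. Qed.

Lemma iscale_ipoint (R : realType) (k a : R) :
  iscale k (ipoint a) = ipoint (k * a).
Proof. by apply: val_inj => /=; rewrite /lo /hi /=; case: ifP. Qed.

Lemma gHsub_ipoint (R : realType) (a b : R) :
  gHsub (ipoint a) (ipoint b) = ipoint (a - b).
Proof. by apply: val_inj => /=; rewrite /lo /hi /= minxx maxxx. Qed.

Lemma ipoint_sum (R : realType) (I : Type) (r : seq I) (P : pred I)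
    (F : I -> R) :
  ipoint (\sum_(i <- r | P i) F i)
  = \big[@iadd R/izero R]_(i <- r | P i) ipoint (F i).
Proof. by apply: big_morph => [a b|]; apply: val_inj. Qed.

(** Splitting the gH-product by the sign of [nu] keeps interval endpoints from
    being exchanged; with one-point intervals there is nothing to exchange and
    the two partial sums recombine. *)
Lemma gHprod_ipoint (R : realType) (n : nat) (nu w : 'rV[R]_n) :
  gHprod nu (fun i => ipoint (w 0 i)) = ipoint (dotp nu w).
Proof.
have split_dotp : \sum_(i < n | 0 <= nu 0 i) nu 0 i * w 0 i
    - \sum_(i < n | nu 0 i < 0) `|nu 0 i| * w 0 i = dotp nu w.
  rewrite /dotp [RHS](bigID (fun i => 0 <= nu 0 i)) /= -sumrN; congr (_ + _).
  apply: eq_big => [i|i nu_lt0]; first by rewrite -ltNge.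
  by rewrite ltr0_norm // mulNr opprK.
rewrite /gHprod; under eq_bigr do rewrite iscale_ipoint.
under [X in gHsub _ X]eq_bigr do rewrite iscale_ipoint.
by rewrite -!ipoint_sum gHsub_ipoint split_dotp.
Qed.

Lemma cvg_dH_lo (R : realType) (T : Type) (F : set_system T) {FF : Filter F}
    (X : T -> cbitv R) (D : cbitv R) :
  dH (X t) D @[t --> F] --> (0 : R) -> lo (X t) @[t --> F] --> lo D.
Proof.
move=> XD; apply/cvgrPdist_lt => e e0.
move/cvgr0Pnorm_lt: XD => /(_ _ e0); apply: filterS => t.
rewrite distrC; apply: le_lt_trans.
by apply: le_trans (ler_norm _); rewrite /dH le_max lexx.
Qed.

Lemma cvg_dH_hi (R : realType) (T : Type) (F : set_system T) {FF : Filter F}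
    (X : T -> cbitv R) (D : cbitv R) :
  dH (X t) D @[t --> F] --> (0 : R) -> hi (X t) @[t --> F] --> hi D.
Proof.
move=> XD; apply/cvgrPdist_lt => e e0.
move/cvgr0Pnorm_lt: XD => /(_ _ e0); apply: filterS => t.
rewrite distrC; apply: le_lt_trans.
by apply: le_trans (ler_norm _); rewrite /dH le_max lexx orbT.
Qed.

Lemma is_gHpartial_unique (R : realType) (n : nat) (h : 'rV[R]_n -> cbitv R)
    (x : 'rV[R]_n) (i : 'I_n) (D1 D2 : cbitv R) :
  is_gHpartial h x i D1 -> is_gHpartial h x i D2 -> D1 = D2.
Proof.
rewrite /is_gHpartial => hD1 hD2; apply: cbitv_eq.
- exact (cvg_unique (@Rhausdorff R) (cvg_dH_lo hD1) (cvg_dH_lo hD2)).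
- exact (cvg_unique (@Rhausdorff R) (cvg_dH_hi hD1) (cvg_dH_hi hD2)).
Qed.

Lemma gHgradE (R : realType) (n : nat) (h : 'rV[R]_n -> cbitv R)
    (x : 'rV[R]_n) (i : 'I_n) (D : cbitv R) :
  is_gHpartial h x i D -> gHgrad h x i = D.
Proof.
by move=> hD; apply: xget_unique => // D' /is_gHpartial_unique; apply.
Qed.

(** Whatever the sign of [t], the interval difference quotient has the two
    endpoint difference quotients as its endpoints, possibly exchanged.  The
    distance to a one-point interval does not see the exchange. *)
Lemma dH_gHquotient_ipoint (R : realType) (a b : cbitv R) (t w : R) :
  dH (iscale t (gHsub a b)) (ipoint w)
  = Num.max `|t * (lo a - lo b) - w| `|t * (hi a - hi b) - w|.
Proof.
set p := lo a - lo b; set q := hi a - hi b.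
rewrite /dH -[lo (iscale _ _)]/(if 0 <= t then t * Num.min p q
  else t * Num.max p q).
rewrite -[hi (iscale _ _)]/(if 0 <= t then t * Num.max p q
  else t * Num.min p q).
rewrite -[lo (ipoint w)]/w -[hi (ipoint w)]/w.
by case: ifP => _; case: (leP p q) => // _; rewrite maxC.
Qed.

Lemma is_gHpartial_ipoint (R : realType) (n : nat) (h : 'rV[R]_n -> cbitv R)
    (x : 'rV[R]_n) (i : 'I_n) (w : R) :
  is_derive x (delta_mx 0 i) (fun y => lo (h y)) w ->
  is_derive x (delta_mx 0 i) (fun y => hi (h y)) w ->
  is_gHpartial h x i (ipoint w).
Proof.
move=> [dlo wlo] [dhi whi].
have {}dlo : t^-1 * (lo (h (x + t *: delta_mx 0 i)) - lo (h x))
    @[t --> (0 : R)^'] --> w.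
  by rewrite -wlo; under eq_fun do rewrite [x + _]addrC; exact: dlo.
have {}dhi : t^-1 * (hi (h (x + t *: delta_mx 0 i)) - hi (h x))
    @[t --> (0 : R)^'] --> w.
  by rewrite -whi; under eq_fun do rewrite [x + _]addrC; exact: dhi.
rewrite /is_gHpartial; under eq_fun do rewrite dH_gHquotient_ipoint.
apply/cvgr0Pnorm_lt => e e0.
move/cvgrPdist_lt: dlo => /(_ _ e0) dlo; move/cvgrPdist_lt: dhi => /(_ _ e0).
move: dlo; apply: filterS2 => t lo_lt hi_lt.
by rewrite ger0_norm ?le_max ?normr_ge0 // gt_max distrC lo_lt distrC hi_lt.
Qed.

Lemma gHgrad_ipoint (R : realType) (n : nat) (h : 'rV[R]_n -> cbitv R)
    (x w : 'rV[R]_n) :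
  differentiable (fun y => lo (h y)) x ->
  differentiable (fun y => hi (h y)) x ->
  grad (fun y => lo (h y)) x = w ->
  grad (fun y => hi (h y)) x = w ->
  gHgrad h x = fun i => ipoint (w 0 i).
Proof.
move=> dlo dhi glo ghi; apply/funext => i; apply: gHgradE.
by apply: is_gHpartial_ipoint; split; try exact: diff_derivable;
  [rewrite -glo | rewrite -ghi]; rewrite mxE.
Qed.

Lemma dotpNr (R : realType) (n : nat) (u w : 'rV[R]_n) :
  dotp u (- w) = - dotp u w.
Proof. by rewrite /dotp -sumrN; apply: eq_bigr => i _; rewrite mxE mulrN. Qed.

Lemma dotp_lincomb (R : realType) (n m : nat) (u : 'rV[R]_n)
    (v : 'I_m -> R) (w : 'I_m -> 'rV[R]_n) :
  dotp u (\sum_(i < m) v i *: w i) = \sum_(i < m) v i * dotp u (w i).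
Proof.
rewrite /dotp; under [RHS]eq_bigr do rewrite mulr_sumr.
rewrite exchange_big; apply: eq_bigr => j _ /=.
by rewrite summxE mulr_sumr; apply: eq_bigr => i _; rewrite mxE mulrCA.
Qed.

(** Here [gx] and [gy] are the constraint values at the candidate and at a
    competing feasible point.  Weighted by the multipliers, the linearised
    constraints change by at most [\sum_i v i * gy i - \sum_i v i * gx i]; the
    first sum is nonpositive by feasibility and the second is zero by
    complementary slackness. *)
Lemma lagrange_dotp_ge0 (R : realType) (n m : nat) (nu : 'rV[R]_n)
    (v gx gy : 'I_m -> R) (dg : 'I_m -> 'rV[R]_n) :
  (forall i, 0 <= v i) -> \sum_(i < m) v i * gx i = 0 ->
  (forall i, gy i <= 0) -> (forall i, dotp nu (dg i) <= gy i - gx i) ->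
  0 <= dotp nu (- \sum_(i < m) v i *: dg i).
Proof.
move=> v_ge0 slack gy_le0 invex.
have neg_slack : \sum_(i < m) - (v i * gx i) = 0 by rewrite sumrN slack oppr0.
rewrite dotpNr dotp_lincomb oppr_ge0 -[leRHS]neg_slack.
apply: ler_sum => i _; rewrite -mulrN; apply: ler_wpM2l => //.
by apply: le_trans (invex i) _; rewrite gerDr.
Qed.

Theorem theorem4p3 (R : realType) (n m : nat) (S : set 'rV[R]_n)
    (E : 'rV[R]_n -> 'rV[R]_n) (Psi : 'rV[R]_n -> 'rV[R]_n -> 'rV[R]_n)
    (h : 'rV[R]_n -> cbitv R) (g : 'I_m -> 'rV[R]_n -> R)
    (zs : 'rV[R]_n) (v : 'I_m -> R)
    (S_open : open S)
    (S_invex : strongly_E_invex S E Psi)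
    (h_SLUEI : SLUEI S E Psi h)
    (g_SEI : forall i, SEI S E Psi (g i))
    (zs_feasible : feasible S E g zs)
    (hL_diff : differentiable (fun x => lo (h x)) (E zs))
    (hU_diff : differentiable (fun x => hi (h x)) (E zs))
    (KKT_L : grad (fun x => lo (h x)) (E zs)
             + \sum_(i < m) v i *: grad (g i) (E zs) = 0)
    (KKT_U : grad (fun x => hi (h x)) (E zs)
             + \sum_(i < m) v i *: grad (g i) (E zs) = 0)
    (compl_slack : \sum_(i < m) v i * g i (E zs) = 0)
    (v_ge0 : forall i, 0 <= v i) :
  non_dominated (feasible S E g) E h zs.
Proof.
case: zs_feasible => Szs gzs_le0; split=> // -[z [[Sz gz_le0] [hz_le hz_neq]]].
set w := - \sum_(i < m) v i *: grad (g i) (E zs).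
have gradL : grad (fun x => lo (h x)) (E zs) = w.
  by apply/eqP; rewrite -addr_eq0 KKT_L.
have gradU : grad (fun x => hi (h x)) (E zs) = w.
  by apply/eqP; rewrite -addr_eq0 KKT_U.
(* Any parameter in [0, 1] would serve, provided it is the same one in the
   objective and in the constraints. *)
have a01 : 0 <= (0 : R) <= 1 by rewrite lexx ler01.
have [incr_ge _] := h_SLUEI.2 z zs Sz Szs 0 a01.
rewrite (gHgrad_ipoint hL_diff hU_diff gradL gradU) gHprod_ipoint in incr_ge.
apply: hz_neq; apply: ile_anti hz_le _; apply: ile_gHsub_ge0.
apply: le_trans incr_ge.
apply: lagrange_dotp_ge0 v_ge0 compl_slack gz_le0 _ => i.
exact: (g_SEI i).2.
Qed.
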